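(* Let $J^3$ be the threefold integration operator on $L^2([0,1])$, $[J^3x](s)=\int_0^s \frac{(s-t)^2}{2}\,x(t)\,dt$ for $0\le s\le 1$. The eigenvalues $\lambda$ of the operator $(J^3)^*J^3$ are exactly the solutions $\lambda>0$ of the nonlinear transcendental equation $$8\cos\bigl(\lambda^{-\frac16}\bigr)+\cos\bigl(2\lambda^{-\frac16}\bigr)+2\cos\bigl(\lambda^{-\frac16}\bigr)\cosh\bigl(\sqrt{3}\,\lambda^{-\frac16}\bigr)+16\cos\bigl(\tfrac12\lambda^{-\frac16}\bigr)\cosh\bigl(\tfrac{\sqrt3}{2}\lambda^{-\frac16}\bigr)+9=0.$$
   Context: $L^2([0,1])$ denotes the Hilbert space of real-valued square-integrable Lebesgue-measurable functions on $[0,1]$. $(J^3)^*$ is the Hilbert space adjoint, $[(J^3)^*z](t)=\int_t^1 \frac{(s-t)^2}{2}\,z(s)\,ds$ for $0\le t\le 1$. Fractional powers of $\lambda>0$ are the positive real ones. *)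

(* Defs.v *)
From HB Require Import structures.
From mathcomp Require Import all_boot all_order all_algebra.
From mathcomp Require Import all_classical all_reals all_analysis.
From mathcomp Require Import measurable_realfun ring lra.

Set Implicit Arguments.
Unset Strict Implicit.
Unset Printing Implicit Defensive.

Import Order.TTheory GRing.Theory Num.Theory.
Import numFieldNormedType.Exports.

Local Open Scope classical_set_scope.
Local Open Scope ring_scope.

Section L2.
Context (R : realType).

Local Notation leb := (@lebesgue_measure R).

Lemma lebesgue_measure01_lty : (leb `[0%R, 1%R] < +oo)%E.
Proof. by rewrite lebesgue_measure_itv/= lte_fin ltr01 oppr0 adde0 ltry. Qed.

Definition lebesgue01 : {finite_measure set (measurableTypeR R) -> \bar R} :=
  @mfrestr _ (measurableTypeR R) R _ leb (measurable_itv _)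
    lebesgue_measure01_lty.

(* The Hilbert space L^2([0, 1]) is given through its representatives: only
   their values on [0, 1] matter, and equality in L^2([0, 1]) is
   [x = y %[ae lebesgue01]]. Representatives are Borel measurable, which loses
   no class: a Lebesgue-measurable function is a.e. equal to a Borel one. *)
Definition L2 := LfunType lebesgue01 (lee1n 2).

Definition inner (x y : L2) : R :=
  \int[lebesgue_measure]_(t in `[0, 1]) (x t * y t).

Definition is_adjoint (A B : L2 -> L2) : Prop :=
  forall x z : L2, inner (A x) z = inner x (B z).

Definition is_eigenvalue (A : L2 -> L2) (lambda : R) : Prop :=
  exists x : L2, ~ (x = cst 0 %[ae lebesgue01]) /\
    A x = lambda *: x %[ae lebesgue01].

(* As functions on R; outside [0, 1] the values of [J3fun x] and [J3adjfun z]
   are irrelevant for the class in L^2([0, 1]). *)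
Definition J3fun (x : R -> R) (s : R) : R :=
  \int[lebesgue_measure]_(t in `[0, s]) ((s - t) ^+ 2 / 2 * x t).

Definition J3adjfun (z : R -> R) (t : R) : R :=
  \int[lebesgue_measure]_(s in `[t, 1]) ((s - t) ^+ 2 / 2 * z s).

Definition cosh (u : R) : R := (expR u + expR (- u)) / 2.

Lemma lebesgue01_ae : {ae lebesgue01, forall t : R, t \in `[0, 1]}.
Proof.
exists (~` `[0%R, 1%R]); split.
- exact: measurableC.
- by rewrite /lebesgue01/= /mfrestr /mrestr setICl measure0.
- by move=> t /=.
Qed.

Lemma integrable01 (f : R -> \bar R) :
  lebesgue01.-integrable setT f -> leb.-integrable `[0%R, 1%R] f.
Proof.
move=> fi01.
have := @integrableS _ (measurableTypeR R) _ lebesgue01 _ `[0%R, 1%R] _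
  measurableT (measurable_itv _) (@subsetT _ _) fi01.
move=> /integrableP[mf fi]; apply/integrableP; split => //.
rewrite (eq_measure_integral lebesgue01)// => A mA A01.
by rewrite /lebesgue01/= /mfrestr /mrestr setIidl.
Qed.

Lemma L2_integrable (x : L2) : leb.-integrable `[0%R, 1%R] (EFin \o x).
Proof.
apply: integrable01; apply/Lfun1_integrable.
apply: Lfun_subset12; last exact: LfunP.
exact: fin_num_measure.
Qed.

Lemma measurable_Rintegral_param (g : R * R -> R) : measurable_fun setT g ->
  measurable_fun setT (fun s => \int[leb]_t g (s, t)).
Proof.
move=> mg; rewrite /Rintegral.
apply: (@measurableT_comp _ _ _ _ _ _ fine).
  exact: fine_measurable.
under eq_fun do rewrite integralE.
have mG : measurable_fun setT (EFin \o g) by exact/measurable_EFinP.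
apply: emeasurable_funB.
- have mGn : @measurable_fun _ _ (measurableTypeR R * measurableTypeR R)%type _
    setT (EFin \o g)^\+%E by exact: measurable_funepos.
  have h := @measurable_fun_fubini_tonelli_F _ _ _ _ _ leb _ mGn.
  rewrite [F in measurable_fun _ F](_ : _ = fubini_F leb (EFin \o g)^\+%E).
    by move=> mT Y mY; exact: (h (fun=> funepos_ge0 _ _) mT Y mY).
  by apply/funext => s; apply: eq_integral => t _; rewrite !funeposE.
- have mGn : @measurable_fun _ _ (measurableTypeR R * measurableTypeR R)%type _
    setT (EFin \o g)^\-%E by exact: measurable_funeneg.
  have h := @measurable_fun_fubini_tonelli_F _ _ _ _ _ leb _ mGn.
  rewrite [F in measurable_fun _ F](_ : _ = fubini_F leb (EFin \o g)^\-%E).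
    by move=> mT Y mY; exact: (h (fun=> funeneg_ge0 _ _) mT Y mY).
  by apply/funext => s; apply: eq_integral => t _; rewrite !funenegE.
Qed.

Lemma bounded_Lfun2 (h : R -> R) (C : R) : measurable_fun setT h ->
  (forall t, t \in `[0, 1] -> `|h t| <= C) -> h \in Lfun lebesgue01 2%:E.
Proof.
move=> mh hC; rewrite inE; apply/andP; split; first by rewrite inE.
rewrite inE/= /finite_norm unlock poweR_lty//.
apply: (@le_lt_trans _ _ (\int[lebesgue01]_t (cst ((C `^ 2)%:E) t))%E).
  apply: ae_ge0_le_integral => //=.
  - apply/measurable_EFinP.
    apply: (@measurableT_comp _ _ _ _ _ _ (@powR R ^~ 2)) => //.
    exact: (@measurableT_comp _ _ _ _ _ _ (@Num.norm _ R)).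
  - by move=> t _; rewrite lee_fin powR_ge0.
  - have [N [mN N0 N01]] := lebesgue01_ae; exists N; split => //.
    apply: subset_trans N01; apply: subsetC => t t01 _ /=.
    rewrite lee_fin ge0_ler_powR ?nnegrE ?hC//.
    by rewrite (le_trans _ (hC _ t01)).
rewrite integral_cst//= lte_mul_pinfty ?lee_fin ?powR_ge0//.
by rewrite -ge0_fin_numE// fin_num_measure.
Qed.

Definition cut (x : L2) : R -> R := x \_ `[0, 1].

Lemma integrable_cut (x : L2) : leb.-integrable setT (EFin \o cut x).
Proof.
have /integrable_mkcond := L2_integrable x.
by move=> /(_ (measurable_itv _)); rewrite restrict_EFin.
Qed.

Lemma measurable_cut (x : L2) : measurable_fun setT (cut x).
Proof. by have /measurable_int/measurable_EFinP := integrable_cut x. Qed.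

Section bounded_kernel.
Variable k : R * R -> R.
Hypothesis mk : measurable_fun setT k.
Hypothesis k1 : forall s, `|k s| <= 1.

Lemma mk2 s : measurable_fun setT (fun t => k (s, t)).
Proof.
apply: (measurableT_comp mk).
exact: pair1_measurable.
Qed.

Lemma integrable_kcut s x :
  leb.-integrable setT (fun t => (k (s, t) * cut x t)%:E).
Proof.
apply: (le_integrable measurableT _ _ (integrable_cut x)).
  apply/measurable_EFinP; apply: measurable_funM; first exact: mk2.
  exact: measurable_cut.
move=> t _ /=; rewrite lee_fin normrM.
by rewrite -[leRHS]mul1r ler_wpM2r.
Qed.

Definition kernelop (x : L2) (s : R) : R := \int[leb]_t (k (s, t) * cut x t).

Lemma kernelop_measurable x : measurable_fun setT (kernelop x).
Proof.
apply: (@measurable_Rintegral_param (fun st => k st * cut x st.2)).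
apply: measurable_funM => //.
exact: (measurableT_comp (measurable_cut x) measurable_snd).
Qed.

Lemma kernelop_bounded x s : `|kernelop x s| <= \int[leb]_t `|cut x t|.
Proof.
have ikx := integrable_kcut s x.
apply: (le_trans (le_normr_Rintegral measurableT ikx)).
apply: le_Rintegral => //.
- exact: (integrable_norm ikx).
- exact: (integrable_norm (integrable_cut x)).
- by move=> t _; rewrite normrM -[leRHS]mul1r ler_wpM2r.
Qed.

End bounded_kernel.

Lemma kernelop_adjoint (k : R * R -> R) (x z : L2) :
  measurable_fun setT k -> (forall st, `|k st| <= 1) ->
  \int[leb]_(s in `[0, 1]) (kernelop k x s * z s) =
  \int[leb]_(t in `[0, 1]) (x t * kernelop (fun ts => k (ts.2, ts.1)) z t).
Proof.
move=> mk k1.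
have mkT : measurable_fun setT (fun ts => k (ts.2, ts.1)).
  apply: (measurableT_comp mk).
  exact: measurable_swap.
pose G (st : R * R) := k st * cut x st.2 * cut z st.1.
have mG : measurable_fun setT G.
  apply: measurable_funM.
    2: exact: (measurableT_comp (measurable_cut z) measurable_fst).
  apply: measurable_funM => //.
  exact: (measurableT_comp (measurable_cut x) measurable_snd).
pose C := \int[leb]_t `|cut x t|.
have GE s : (\int[leb]_t (G (s, t))%:E = (kernelop k x s * cut z s)%:E)%E.
  rewrite EFinM /kernelop /Rintegral fineK; last first.
    exact: (integrable_fin_num measurableT (integrable_kcut mk k1 s x)).
  rewrite -integralZr//; last exact: integrable_kcut.
have GT t : (\int[leb]_s (G (s, t))%:E =
    (cut x t * kernelop (fun ts => k (ts.2, ts.1)) z t)%:E)%E.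
  rewrite EFinM /kernelop /Rintegral fineK; last first.
    exact: (integrable_fin_num measurableT (integrable_kcut mkT _ t z)).
  rewrite -integralZl//; last exact: (integrable_kcut mkT).
  by apply: eq_integral => s _; rewrite -EFinM /G; congr EFin => /=; ring.
have iG : (leb \x leb)%E.-integrable setT (EFin \o G).
  apply/integrable12ltyP; first by apply/measurable_EFinP.
  have iz := integrable_norm (integrable_cut z).
  have iCz : leb.-integrable setT (fun s => C%:E * (`|cut z s|)%:E)%E.
    exact: (integrableZl measurableT C iz).
  have mGabs : measurable_fun setT (abse \o (EFin \o G)).
    by apply: measurableT_comp => //; exact/measurable_EFinP.
  apply: (@le_lt_trans _ _ (\int[leb]_s (C%:E * (`|cut z s|)%:E))%E).
    apply: ge0_le_integral => //.
    - by move=> s _; apply: integral_ge0.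
    - exact: (@measurable_fun_fubini_tonelli_F _ _ (measurableTypeR R)
        (measurableTypeR R) R leb _ mGabs (fun=> abse_ge0 _)).
    - exact: measurable_int iCz.
    - move=> s _.
      have icx := integrable_norm (integrable_cut x).
      rewrite /C /Rintegral fineK; last first.
        exact: (integrable_fin_num measurableT icx).
      rewrite -integralZr//; apply: ge0_le_integral => //.
      + apply: (@measurableT_comp _ _ _ _ _ _ (abse : \bar R -> \bar R)) => //.
        apply/measurable_EFinP.
        exact: (measurableT_comp mG (pair1_measurable s)).
      + apply: emeasurable_funM; last exact: measurable_cst.
        exact: measurable_int icx.
      + move=> t _ /=; rewrite lee_fin !normrM -mulrA -[leRHS]mul1r.
        by rewrite ler_wpM2r// mulr_ge0.
  have := integrable_lty measurableT iCz.
  exact.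
have FG := Fubini iG.
rewrite [LHS]Rintegral_mkcond [RHS]Rintegral_mkcond /Rintegral.
transitivity (fine (\int[leb]_s \int[leb]_t (EFin \o G) (s, t))).
  congr fine; apply: eq_integral => s _.
  rewrite GE /cut !patchE; case: ifPn => // _.
  by rewrite mulr0.
rewrite FG; congr fine; apply: eq_integral => t _.
rewrite GT /cut !patchE; case: ifPn => // _.
by rewrite mul0r.
Qed.

Definition kerJ3 (st : R * R) : R :=
  if (0 <= st.2) && (st.2 <= st.1) && (st.1 <= 1) then (st.1 - st.2) ^+ 2 / 2
  else 0.

Lemma mkerJ3 : measurable_fun setT kerJ3.
Proof.
apply: measurable_fun_ifT => //.
- apply: measurable_and; first apply: measurable_and.
  + exact: measurable_fun_ler.
  + exact: measurable_fun_ler.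
  + exact: measurable_fun_ler.
- apply: measurable_funM => //; apply: measurable_funX.
  exact: measurable_funB.
Qed.

Lemma kerJ3_le1 st : `|kerJ3 st| <= 1.
Proof.
rewrite /kerJ3; case: ifPn => [/andP[/andP[]]|_]; last by rewrite normr0.
by case: st => s t /= t0 ts s1; rewrite ger0_norm; nra.
Qed.

Lemma J3fun_kernelop (x : L2) s : s \in `[0, 1] ->
  J3fun x s = kernelop kerJ3 x s.
Proof.
rewrite in_itv/= => /andP[s0 s1].
rewrite /J3fun Rintegral_mkcond; apply: eq_Rintegral => t _.
rewrite /kerJ3 /cut !patchE/= s1 andbT !mem_setE !in_itv/=.
case: ifPn => [/andP[t0 ts]|]; last by rewrite mul0r.
by rewrite t0 (le_trans ts s1).
Qed.

Lemma J3adjfun_kernelop (z : L2) t : t \in `[0, 1] ->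
  J3adjfun z t = kernelop (fun ts => kerJ3 (ts.2, ts.1)) z t.
Proof.
rewrite in_itv/= => /andP[t0 t1].
rewrite /J3adjfun Rintegral_mkcond; apply: eq_Rintegral => s _.
rewrite /kerJ3 /cut !patchE/= t0/= !mem_setE !in_itv/=.
case: ifPn => [/andP[ts s1]|]; last by rewrite mul0r.
by rewrite s1 (le_trans t0 ts).
Qed.

Lemma J3fun_Lfun (x : L2) : J3fun x \in Lfun lebesgue01 2%:E.
Proof.
apply: (@bounded_Lfun2 _ (\int[leb]_t `|cut x t|)); last first.
  move=> s s01; rewrite J3fun_kernelop//.
  exact: (kernelop_bounded mkerJ3 kerJ3_le1).
pose g (st : R * R) := if (0 <= st.2) && (st.2 <= st.1) then
  (st.1 - st.2) ^+ 2 / 2 * x st.2 else 0.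
rewrite [F in measurable_fun _ F](_ : _ = fun s => \int[leb]_t g (s, t)).
  apply: measurable_Rintegral_param; apply: measurable_fun_ifT => //.
    by apply: measurable_and; exact: measurable_fun_ler.
  apply: measurable_funM.
    apply: measurable_funM => //; apply: measurable_funX.
    exact: measurable_funB.
  exact: (measurableT_comp (measurable_funPT x) measurable_snd).
apply/funext => s; rewrite /J3fun Rintegral_mkcond.
by apply: eq_Rintegral => t _; rewrite patchE mem_setE in_itv.
Qed.

Lemma J3adjfun_Lfun (z : L2) : J3adjfun z \in Lfun lebesgue01 2%:E.
Proof.
apply: (@bounded_Lfun2 _ (\int[leb]_t `|cut z t|)); last first.
  move=> t t01; rewrite J3adjfun_kernelop//.
  apply: kernelop_bounded; last by move=> ?; exact: kerJ3_le1.
  by apply: (measurableT_comp mkerJ3); exact: measurable_swap.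
pose g (ts : R * R) := if (ts.1 <= ts.2) && (ts.2 <= 1) then
  (ts.2 - ts.1) ^+ 2 / 2 * z ts.2 else 0.
rewrite [F in measurable_fun _ F](_ : _ = fun t => \int[leb]_s g (t, s)).
  apply: measurable_Rintegral_param; apply: measurable_fun_ifT => //.
    by apply: measurable_and; exact: measurable_fun_ler.
  apply: measurable_funM.
    apply: measurable_funM => //; apply: measurable_funX.
    exact: measurable_funB.
  exact: (measurableT_comp (measurable_funPT z) measurable_snd).
apply/funext => t; rewrite /J3adjfun Rintegral_mkcond.
by apply: eq_Rintegral => s _; rewrite patchE mem_setE in_itv.
Qed.

Definition J3 (x : L2) : L2 := Lfun_Sub (lee1n 2) (J3fun_Lfun x).

Definition J3adj (z : L2) : L2 := Lfun_Sub (lee1n 2) (J3adjfun_Lfun z).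

Lemma J3adjP : is_adjoint J3 J3adj.
Proof.
move=> x z; rewrite /inner.
transitivity (\int[leb]_(s in `[0, 1]) (kernelop kerJ3 x s * z s)).
  by apply: eq_Rintegral => s /[!inE] s01; rewrite /= J3fun_kernelop.
rewrite (kernelop_adjoint _ _ mkerJ3 kerJ3_le1).
apply: eq_Rintegral => t /[!inE] t01.
by rewrite /= J3adjfun_kernelop.
Qed.

End L2.

(* Main.v *)
Require Import Defs.
From mathcomp Require Import all_boot all_order all_algebra.
From mathcomp Require Import all_classical all_reals all_analysis.
From mathcomp Require Import measurable_realfun ring lra.

Import Order.TTheory GRing.Theory Num.Theory.
Import numFieldNormedType.Exports.

Local Open Scope ring_scope.

(** Put w = lambda^(-1/6). If x is an eigenfunction for lambda > 0 and z = J3 x,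
    then z''' = x with z, z', z'' vanishing at 0, while lambda x = J3adj z says
    (lambda x)''' = - z with x, x', x'' vanishing at 1. Hence z solves
    z^(6) = - w^6 z. The solutions of this equation are spanned by the
    functions phi_k (w t), where phi_k (u) = sum_j (-1)^j u^(6j+k) / (6j+k)! is
    the solution of f^(6) = - f whose only nonzero derivative of order < 6 at 0
    is the k-th one. The conditions at 0 leave the three-parameter family
    x = a phi_0 (w t) + b phi_1 (w t) + c phi_2 (w t), and the conditions at 1
    form a linear 3 x 3 system in a, b, c with matrix [boundary_mx w]. So lambda is
    an eigenvalue exactly when the determinant of that matrix vanishes, and
    by trigonometry ([det_boundary_mx]) 36 times this determinant is the left-hand
    side of the transcendental equation.

    Two points need more than calculus.

    An eigenfunction is only given as a class in L^2, so its smoothness has to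
    be established. By Fubini, J3 x is the iterated primitive of the continuous
    function s |-> int_0^s x ([J3fun_regular]), so z is continuous; therefore
    J3adj z, and with it x up to a null set, is smooth
    ([boundary_conditions_of_eigenvalue]). All primitives are taken on the whole
    line, so that no one-sided derivative occurs at 0 and 1.

    Eigenvalues are positive ([eigenvalue_gt0]): if lambda <= 0, then
    <J3 x, J3 x> = <x, J3adj (J3 x)> = lambda <x, x> <= 0 gives J3 x = 0, and J3
    is injective, because differentiating twice shows int_0^s x = 0 for all s and
    the Lebesgue differentiation theorem gives x = 0 almost everywhere
    ([J3fun_eq0]). *)

(** * Pointwise rules of derivation *)

Section Derivatives.
Context {R : realType}.
Implicit Types f g : R -> R.

(** The rules for sums and products are restated here for functions given
    pointwise: the derivative of a formula is then obtained by composing these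
    lemmas along its syntax. *)
Lemma derD {f g} {x a b : R} : is_derive x 1 f a -> is_derive x 1 g b ->
  is_derive x 1 (fun t => f t + g t) (a + b).
Proof. exact: is_deriveD. Qed.

Lemma derB {f g} {x a b : R} : is_derive x 1 f a -> is_derive x 1 g b ->
  is_derive x 1 (fun t => f t - g t) (a - b).
Proof. exact: is_deriveB. Qed.

Lemma derN {f} {x a : R} : is_derive x 1 f a ->
  is_derive x 1 (fun t => - f t) (- a).
Proof. exact: is_deriveN. Qed.

Lemma derM {f g} {x a b : R} : is_derive x 1 f a -> is_derive x 1 g b ->
  is_derive x 1 (fun t => f t * g t) (f x * b + g x * a).
Proof. exact: is_deriveM. Qed.

Lemma derZ (k : R) {f} {x a : R} : is_derive x 1 f a ->
  is_derive x 1 (fun t => k * f t) (k * a).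
Proof. exact: is_deriveZ. Qed.

Lemma derZr (k : R) {f} {x a : R} : is_derive x 1 f a ->
  is_derive x 1 (fun t => f t * k) (a * k).
Proof.
move=> fa; rewrite mulrC; under eq_fun do rewrite mulrC.
exact: derZ.
Qed.

Lemma der_comp_scale (k : R) {f} {x a : R} : is_derive (k * x) 1 f a ->
  is_derive x 1 (fun t => f (k * t)) (k * a).
Proof.
move=> fa; rewrite mulrC.
apply: (@is_derive1_comp _ f (fun t => k * t)) => //.
by apply: (is_derive_eq (derZ k (is_derive_id x 1))); rewrite mulr1.
Qed.

Lemma der_comp_refl (w a : R) {f} {x d : R} : is_derive (w * (a - x)) 1 f d ->
  is_derive x 1 (fun t => f (w * (a - t))) (- (w * d)).
Proof.
move=> fd; rewrite mulrC -mulrN.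
apply: (@is_derive1_comp _ f (fun t => w * (a - t))) => //.
apply: (is_derive_eq (derZ w (derB (is_derive_cst a x 1) (is_derive_id x 1)))).
by rewrite sub0r mulrN mulr1.
Qed.

End Derivatives.

(** * A fundamental system of f^(6) = - f *)

Section Order6.
Context {R : realType}.
Implicit Types u : R.

Definition sinh u : R := (expR u - expR (- u)) / 2.

Lemma der_expRN u : is_derive u 1 (fun t : R => expR (- t)) (- expR (- u)).
Proof.
have := @is_derive1_comp _ expR -%R u _ _ (is_derive_expR _) (is_deriveNid _ _).
by rewrite mulrN1.
Qed.

Lemma der_cosh u : is_derive u 1 (@cosh R) (sinh u).
Proof.
apply: (is_derive_eq (derZr 2^-1 (derD (is_derive_expR u) (der_expRN u)))).
by rewrite /sinh; ring.
Qed.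

Lemma der_sinh u : is_derive u 1 sinh (cosh u).
Proof.
apply: (is_derive_eq (derZr 2^-1 (derB (is_derive_expR u) (der_expRN u)))).
by rewrite /cosh; ring.
Qed.

Lemma cosh2_sinh2 u : cosh u ^+ 2 - sinh u ^+ 2 = 1.
Proof.
rewrite /cosh /sinh expRN; field.
exact: lt0r_neq0 (expR_gt0 u).
Qed.

Lemma cosh_double u : cosh (2 * u) = cosh u ^+ 2 + sinh u ^+ 2.
Proof.
have E x : expR (2 * x) = expR x * expR x :> R.
  by rewrite mulr2n mulrDl !mul1r expRD.
by rewrite /cosh /sinh -mulrN !E; field.
Qed.

Local Notation r := (Num.sqrt 3 : R).
Definition cos_cosh u : R := cos (1 / 2 * u) * cosh (r / 2 * u).
Definition sin_sinh u : R := sin (1 / 2 * u) * sinh (r / 2 * u).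
Definition cos_sinh u : R := cos (1 / 2 * u) * sinh (r / 2 * u).
Definition sin_cosh u : R := sin (1 / 2 * u) * cosh (r / 2 * u).

Lemma der_cos_cosh u :
  is_derive u 1 cos_cosh (r / 2 * cos_sinh u - 1 / 2 * sin_cosh u).
Proof.
apply: (is_derive_eq (derM (der_comp_scale _ (is_derive_cos _))
    (der_comp_scale _ (der_cosh _)))).
by rewrite /cos_sinh /sin_cosh; ring.
Qed.

Lemma der_sin_sinh u :
  is_derive u 1 sin_sinh (r / 2 * sin_cosh u + 1 / 2 * cos_sinh u).
Proof.
apply: (is_derive_eq (derM (der_comp_scale _ (is_derive_sin _))
    (der_comp_scale _ (der_sinh _)))).
by rewrite /cos_sinh /sin_cosh; ring.
Qed.

Lemma der_cos_sinh u :
  is_derive u 1 cos_sinh (r / 2 * cos_cosh u - 1 / 2 * sin_sinh u).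
Proof.
apply: (is_derive_eq (derM (der_comp_scale _ (is_derive_cos _))
    (der_comp_scale _ (der_sinh _)))).
by rewrite /cos_cosh /sin_sinh; ring.
Qed.

Lemma der_sin_cosh u :
  is_derive u 1 sin_cosh (r / 2 * sin_sinh u + 1 / 2 * cos_cosh u).
Proof.
apply: (is_derive_eq (derM (der_comp_scale _ (is_derive_sin _))
    (der_comp_scale _ (der_cosh _)))).
by rewrite /cos_cosh /sin_sinh; ring.
Qed.

(** The roots of X^6 + 1 are i, -i and (+- sqrt 3 +- i) / 2, so the real
    solutions of f^(6) = - f are spanned by cos, sin and the four products above.
    The combinations below are normalised by [phi_at0], so that
    phi_k (u) = sum_j (-1)^j u^(6j+k) / (6j+k)!. *)
Definition phi0 u : R := 3^-1 * (cos u + 2 * cos_cosh u).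
Definition phi1 u : R := 3^-1 * (sin u + (sin_cosh u + r * cos_sinh u)).
Definition phi2 u : R := 3^-1 * (- cos u + (cos_cosh u + r * sin_sinh u)).
Definition phi3 u : R := 3^-1 * (- sin u + 2 * sin_cosh u).
Definition phi4 u : R := 3^-1 * (cos u + (r * sin_sinh u - cos_cosh u)).
Definition phi5 u : R := 3^-1 * (sin u + (sin_cosh u - r * cos_sinh u)).

Lemma sqr_sqrt3 : r ^+ 2 = 3. Proof. by rewrite sqr_sqrtr. Qed.

Lemma der_phi0 u : is_derive u 1 phi0 (- phi5 u).
Proof.
apply: (is_derive_eq (derZ 3^-1 (derD (is_derive_cos _)
  (derZ 2 (der_cos_cosh u))))).
by rewrite /phi5; field.
Qed.

Lemma der_phi1 u : is_derive u 1 phi1 (phi0 u).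
Proof.
apply: (is_derive_eq (derZ 3^-1 (derD (is_derive_sin _)
  (derD (der_sin_cosh u) (derZ r (der_cos_sinh u)))))).
by rewrite /phi0; field: sqr_sqrt3.
Qed.

Lemma der_phi2 u : is_derive u 1 phi2 (phi1 u).
Proof.
apply: (is_derive_eq (derZ 3^-1 (derD (derN (is_derive_cos _))
  (derD (der_cos_cosh u) (derZ r (der_sin_sinh u)))))).
by rewrite /phi1; field: sqr_sqrt3.
Qed.

Lemma der_phi3 u : is_derive u 1 phi3 (phi2 u).
Proof.
apply: (is_derive_eq (derZ 3^-1 (derD (derN (is_derive_sin _))
  (derZ 2 (der_sin_cosh u))))).
by rewrite /phi2; field.
Qed.

Lemma der_phi4 u : is_derive u 1 phi4 (phi3 u).
Proof.
apply: (is_derive_eq (derZ 3^-1 (derD (is_derive_cos _)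
  (derB (derZ r (der_sin_sinh u)) (der_cos_cosh u))))).
by rewrite /phi3; field: sqr_sqrt3.
Qed.

Lemma der_phi5 u : is_derive u 1 phi5 (phi4 u).
Proof.
apply: (is_derive_eq (derZ 3^-1 (derD (is_derive_sin _)
  (derB (der_sin_cosh u) (derZ r (der_cos_sinh u)))))).
by rewrite /phi4; field: sqr_sqrt3.
Qed.

Lemma phi_at0 : [/\ phi0 0 = 1, phi1 0 = 0, phi2 0 = 0
  & [/\ phi3 0 = 0, phi4 0 = 0 & phi5 0 = 0]].
Proof.
have C0 : cosh 0 = 1 :> R by rewrite /cosh oppr0 expR0; field.
have S0 : sinh 0 = 0 by rewrite /sinh oppr0 subrr mul0r.
rewrite /phi0 /phi1 /phi2 /phi3 /phi4 /phi5 /cos_cosh /sin_sinh /cos_sinh /sin_cosh.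
by rewrite !mulr0 cos0 sin0 C0 S0; split; last split; field.
Qed.

(** The determinant of the boundary conditions at 1 is the polynomial on the left.
    In terms of the sine, cosine, hyperbolic sine and hyperbolic cosine of the
    half arguments u / 2 and sqrt 3 u / 2 both sides are polynomials that agree
    modulo cos^2 = 1 - sin^2, cosh^2 = 1 + sinh^2 and (sqrt 3)^2 = 3. *)
Lemma det_phi u :
  36 * (phi0 u ^+ 3 + 2 * phi0 u * phi1 u * phi5 u - phi1 u ^+ 2 * phi4 u
    + phi2 u * phi5 u ^+ 2 + phi0 u * phi2 u * phi4 u) =
  8 * cos u + cos (2 * u) + 2 * cos u * cosh (r * u)
  + 16 * cos (1 / 2 * u) * cosh (r / 2 * u) + 9.
Proof.
rewrite (_ : r * u = 2 * (r / 2 * u)); last by field.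
rewrite cosh_double.
have dbl x : 2 * x = x + x :> R by ring.
have uE : u = 1 / 2 * u + 1 / 2 * u by field.
rewrite (dbl u) cosD.
rewrite /phi0 /phi1 /phi2 /phi4 /phi5 /cos_cosh /sin_sinh /cos_sinh /sin_cosh.
have -> : sin u = 2 * sin (1 / 2 * u) * cos (1 / 2 * u).
  by rewrite [in LHS]uE sinD; ring.
have -> : cos u = cos (1 / 2 * u) ^+ 2 - sin (1 / 2 * u) ^+ 2.
  by rewrite [in LHS]uE cosD; ring.
have c2 : cos (1 / 2 * u) ^+ 2 = 1 - sin (1 / 2 * u) ^+ 2 := cos2sin2 _.
have C2 : cosh (r / 2 * u) ^+ 2 = 1 + sinh (r / 2 * u) ^+ 2.
  by have := cosh2_sinh2 (r / 2 * u); lra.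
by field: c2 C2 sqr_sqrt3.
Qed.

End Order6.

(** * Primitives and vanishing derivatives *)

Section Calculus.
Local Open Scope classical_set_scope.
Context {R : realType}.
Notation mu := (@lebesgue_measure R).
Implicit Types (f F : R -> R) (a b t x : R).

Lemma is_derive_continuous {f df : R -> R} :
  (forall x, is_derive x 1 f (df x)) -> continuous f.
Proof.
by move=> fE x; apply/differentiable_continuous/derivable1_diffP; have [] := fE x.
Qed.

Lemma is_derive0_itv_cst f a b : a <= b ->
  (forall t, a <= t <= b -> is_derive t 1 f 0) -> f a = f b.
Proof.
move=> ab f0.
have fE t : t \in `[a, b]%R -> is_derive t 1 f 0 by rewrite in_itv/=; exact: f0.
have fI t : t \in `]a, b[%R -> is_derive t 1 f (cst 0 t).
  by move=> /subset_itv_oo_cc/fE.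
have fc : {within `[a, b], continuous f}.
  by apply: derivable_within_continuous => t /fE[].
have [c _] := MVT_segment ab fI fc.
by rewrite mul0r => /eqP; rewrite subr_eq0 => /eqP.
Qed.

Lemma Rintegral_primitive f F a b : a <= b -> continuous f ->
  (forall x, is_derive x 1 F (f x)) ->
  \int[mu]_(t in `[a, b]) f t = F b - F a.
Proof.
move=> ab cf FE; have cF := is_derive_continuous FE.
move: ab; rewrite le_eqVlt => /predU1P[<-|ab].
  by rewrite set_itv1 Rintegral_set1 subrr.
rewrite /Rintegral (continuous_FTC2 (F := F) ab)//.
- exact: continuous_subspaceT.
- split; first by move=> x _; have [] := FE x.
    exact: cvg_at_right_filter (cF a).
  exact: cvg_at_left_filter (cF b).
- by move=> x _; rewrite derive1E; have [] := FE x.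
Qed.

Lemma continuous_integrable f a b : continuous f ->
  mu.-integrable `[a, b] (EFin \o f).
Proof.
move=> cf; apply: continuous_compact_integrable; first exact: segment_compact.
exact: continuous_subspaceT.
Qed.

Lemma continuous_mul {f g : R -> R} : continuous f -> continuous g ->
  continuous (fun t => f t * g t).
Proof. by move=> cf cg t; apply: (@continuousM R R f g t); [exact: cf|exact: cg]. Qed.

(** The integral of f over [a, x] is a primitive only for x > a. The signed
    integral F is a primitive on the whole line because near each x it differs by
    a constant from an integral based at a point to the left of a and x. *)
Lemma primitive_exists f a : continuous f ->
  exists F, F a = 0 /\ forall x, is_derive x 1 F (f x).
Proof.
move=> cf.
pose I b x := \int[mu]_(t in `[b, x]) f t.
have IE b x : b < x -> is_derive x 1 (I b) (f x).
  move=> bx.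
  have [||dI EI] := @continuous_FTC1_closed R f b x (x + 1) _ _ bx (cf x).
  - by rewrite ltrDl.
  - exact: continuous_integrable.
  by apply: DeriveDef => //; rewrite -derive1E.
have IB b c x : b < c -> c <= x ->
    I b x - I b c = \int[mu]_(t in `]c, x]) f t.
  move=> bc cx; rewrite /I Rintegral_itvB//.
  - exact: continuous_integrable.
  - by rewrite bnd_simp ltW.
pose F x := \int[mu]_(t in `]a, x]) f t - \int[mu]_(t in `]x, a]) f t.
have FE b x : b < a -> b < x -> F x = I b x - I b a.
  move=> ba bx; rewrite /F; case: (leP a x) => [ax|/ltW xa].
    rewrite [X in _ - X](_ : _ = 0) ?subr0 ?IB//.
    by rewrite set_itv_ge ?Rintegral_set0// bnd_simp -leNgt.
  rewrite [X in X - _](_ : _ = 0); last first.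
    by rewrite set_itv_ge ?Rintegral_set0// bnd_simp -leNgt.
  by rewrite -(IB b)// sub0r opprB.
exists F; split; first by rewrite (FE (a - 1)) ?subrr// ltrBlDr ltrDl.
move=> x; pose b := Num.min x a - 1.
have [bx ba] : b < x /\ b < a.
  have : Num.min x a <= x /\ Num.min x a <= a by rewrite !ge_min !lexx orbT.
  by rewrite /b; lra.
have H : is_derive x 1 (fun y => I b y - I b a) (f x - 0).
  exact: derB (IE _ _ bx) (is_derive_cst _ _ _).
rewrite subr0 in H.
apply: near_eq_is_derive H.
near=> y; rewrite (FE b)//; near: y.
exact: lt_nbhsr.
Unshelve. all: by end_near. Qed.

(** The derivative at t is also the right derivative, which only sees the zeros of
    F to the right of t; this covers the endpoint of an interval. *)
Lemma zero_is_derive (F : R -> R) (d b t : R) : t < b ->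
  (forall s, t <= s < b -> F s = 0) -> is_derive t 1 F d -> d = 0.
Proof.
move=> tb F0 [dF <-].
have := dF; rewrite /derivable => cF.
have : (h^-1 *: ((F \o shift t) (h *: 1) - F t) @[h --> 0^'+] --> 'D_1 F t).
  apply: cvg_trans cF; apply: cvg_app; apply: within_subset => h /=.
  by move=> /lt0r_neq0.
move=> H; apply: cvg_unique H _; first exact: Rhausdorff.
apply: cvg_near_cst; near=> h.
rewrite /= [h *: _]mulr1 !F0 ?subrr ?scaler0 ?lexx ?tb//.
have h0 : 0 < h by near: h; exact: nbhs_right_gt.
have hb : h < b - t by near: h; apply: nbhs_right_lt; rewrite subr_gt0.
by apply/andP; split; lra.
Unshelve. all: by end_near. Qed.

Lemma vanishing_derivative (F f : R -> R) (a b : R) :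
  (forall t : R, is_derive t 1 F (f t)) ->
  (forall s, a <= s < b -> F s = 0) -> forall s, a <= s < b -> f s = 0.
Proof.
move=> dF F0 s /andP[a_s sb].
apply: (zero_is_derive F (f s) b s sb _ (dF s)) => u /andP[su ub].
by rewrite F0// (le_trans a_s su).
Qed.

End Calculus.

(** * Taylor formula for the sixth-order equation *)

Section Taylor.
Context {R : realType}.
Implicit Types (w a t : R).

(** The sum G (t) = v0 (t) phi_0 (w (a - t)) + ... + v5 (t) phi_5 (w (a - t)) has
    derivative 0, since differentiating v_k raises the index of v and
    differentiating phi_k lowers that of phi. At a it equals v0 (a), as
    phi_0 (0) = 1 and the other phi_k vanish at 0; at 0 it is the right-hand
    side. *)
Lemma taylor6 (w a : R) (v0 v1 v2 v3 v4 v5 : R -> R) : 0 <= a ->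
  (forall t, 0 <= t <= a -> is_derive t 1 v0 (w * v1 t)) ->
  (forall t, 0 <= t <= a -> is_derive t 1 v1 (w * v2 t)) ->
  (forall t, 0 <= t <= a -> is_derive t 1 v2 (w * v3 t)) ->
  (forall t, 0 <= t <= a -> is_derive t 1 v3 (w * v4 t)) ->
  (forall t, 0 <= t <= a -> is_derive t 1 v4 (w * v5 t)) ->
  (forall t, 0 <= t <= a -> is_derive t 1 v5 (w * - v0 t)) ->
  v0 a = v0 0 * phi0 (w * a) + v1 0 * phi1 (w * a) + v2 0 * phi2 (w * a)
       + v3 0 * phi3 (w * a) + v4 0 * phi4 (w * a) + v5 0 * phi5 (w * a).
Proof.
move=> a0 d0 d1 d2 d3 d4 d5.
pose G t := v0 t * phi0 (w * (a - t)) + v1 t * phi1 (w * (a - t))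
  + v2 t * phi2 (w * (a - t)) + v3 t * phi3 (w * (a - t))
  + v4 t * phi4 (w * (a - t)) + v5 t * phi5 (w * (a - t)).
have G0 t : 0 <= t <= a -> is_derive t 1 G 0.
  move=> ta.
  apply: (is_derive_eq (derD (derD (derD (derD (derD
    (derM (d0 t ta) (der_comp_refl w a (der_phi0 _)))
    (derM (d1 t ta) (der_comp_refl w a (der_phi1 _))))
    (derM (d2 t ta) (der_comp_refl w a (der_phi2 _))))
    (derM (d3 t ta) (der_comp_refl w a (der_phi3 _))))
    (derM (d4 t ta) (der_comp_refl w a (der_phi4 _))))
    (derM (d5 t ta) (der_comp_refl w a (der_phi5 _))))).
  by ring.
have := is_derive0_itv_cst G 0 a a0 G0.
have [E0 E1 E2 [E3 E4 E5]] := @phi_at0 R.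
rewrite /G subrr subr0 mulr0 E0 E1 E2 E3 E4 E5 => ->.
by ring.
Qed.

End Taylor.

(** * The operators on smooth functions and on classes *)

Section Operators.
Local Open Scope classical_set_scope.
Context {R : realType}.
Notation mu := (@lebesgue_measure R).
Notation mu01 := (@lebesgue01 R).

(** The primitive of (s - t)^2 / 2 * z0''' (t) used here comes from integrating
    by parts three times; it equals z0 (s) at s and vanishes at 0. *)
Lemma J3fun_primitive {f z0 z1 z2 : R -> R} : continuous f ->
  (forall t : R, is_derive t 1 z0 (z1 t)) ->
  (forall t : R, is_derive t 1 z1 (z2 t)) ->
  (forall t : R, is_derive t 1 z2 (f t)) ->
  z0 0 = 0 -> z1 0 = 0 -> z2 0 = 0 ->
  forall s : R, 0 <= s -> J3fun f s = z0 s.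
Proof.
move=> cf d0 d1 d2 z00 z10 z20 s s0.
pose H t := (s - t) ^+ 2 / 2 * z2 t + (s - t) * z1 t + z0 t.
have ds (t : R) : is_derive t 1 (fun t : R => s - t) (- 1).
  apply: (is_derive_eq (derB (is_derive_cst s t 1) (is_derive_id t 1))).
  by rewrite sub0r.
have dk (t : R) : is_derive t 1 (fun t : R => (s - t) ^+ 2 / 2) (- (s - t)).
  apply: (is_derive_eq (derZr 2^-1 (derM (ds t) (ds t)))).
  by field.
have dH (t : R) : is_derive t 1 H ((s - t) ^+ 2 / 2 * f t).
  apply: (is_derive_eq (derD (derD (derM (dk t) (d2 t)) (derM (ds t) (d1 t))) (d0 t))).
  by field.
rewrite /J3fun (@Rintegral_primitive R (fun t => (s - t) ^+ 2 / 2 * f t) H)//.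
  by rewrite /H z00 z10 z20 subrr; ring.
exact: continuous_mul (is_derive_continuous dk) cf.
Qed.

Lemma J3adjfun_primitive {f y0 y1 y2 : R -> R} : continuous f ->
  (forall t : R, is_derive t 1 y0 (y1 t)) ->
  (forall t : R, is_derive t 1 y1 (y2 t)) ->
  (forall t : R, is_derive t 1 y2 (- f t)) ->
  y0 1 = 0 -> y1 1 = 0 -> y2 1 = 0 ->
  forall t : R, t <= 1 -> J3adjfun f t = y0 t.
Proof.
move=> cf d0 d1 d2 y01 y11 y21 t t1.
pose H s := - ((s - t) ^+ 2 / 2 * y2 s) + (s - t) * y1 s - y0 s.
have ds (s : R) : is_derive s 1 (fun s : R => s - t) 1.
  apply: (is_derive_eq (derB (is_derive_id s 1) (is_derive_cst t s 1))).
  by rewrite subr0.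
have dk (s : R) : is_derive s 1 (fun s : R => (s - t) ^+ 2 / 2) (s - t).
  apply: (is_derive_eq (derZr 2^-1 (derM (ds s) (ds s)))).
  by field.
have dH (s : R) : is_derive s 1 H ((s - t) ^+ 2 / 2 * f s).
  apply: (is_derive_eq (derB (derD (derN (derM (dk s) (d2 s)))
    (derM (ds s) (d1 s))) (d0 s))).
  by field.
rewrite /J3adjfun (@Rintegral_primitive R (fun s => (s - t) ^+ 2 / 2 * f s) H)//.
  by rewrite /H y01 y11 y21 subrr; ring.
exact: continuous_mul (is_derive_continuous dk) cf.
Qed.

(** The measure [lebesgue01] lives on the whole line, where the complement
    of the unit interval is a null set. *)
Lemma ae_lebesgue01 (P : R -> Prop) :
  (\forall t \ae mu01, P t) <-> (\forall t \ae mu, t \in `[0, 1]%R -> P t).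
Proof.
have m01 : measurable (`[0, 1] : set R) by exact: measurable_itv.
split=> -[N [mN N0 NP]].
- exists (N `&` `[0, 1]); split; first exact: measurableI.
  + by rewrite -N0 /lebesgue01/= /mfrestr /mrestr.
  + move=> t /= /not_implyP[t01 Pt]; split => //; exact: NP.
- exists (N `|` ~` `[0, 1]); split.
  + by apply: measurableU => //; exact: measurableC.
  + rewrite /lebesgue01/= /mfrestr /mrestr setIUl setICl setU0.
    apply: (@subset_measure0 _ _ _ mu _ _ _ mN _ N0); last exact: subIsetl.
    exact: measurableI.
  + move=> t /= Pt; case: (pselect (t \in `[0, 1]%R)) => t01; last by right.
    by left; apply: NP => /= /(_ t01).
Qed.

Lemma ae_monotone (P Q : R -> Prop) : (forall t, P t -> Q t) ->
  (\forall t \ae mu, P t) -> (\forall t \ae mu, Q t).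
Proof.
move=> PQ [N [mN N0 NP]]; exists N; split => //.
by move=> t /= Qt; apply: NP => /= /PQ.
Qed.

Lemma eq_ae_lebesgue01 (f g : R -> R) :
  f = g %[ae mu01] <-> (\forall t \ae mu, t \in `[0, 1]%R -> f t = g t).
Proof.
rewrite (ae_lebesgue01 (fun t => [set: R] t -> f t = g t)).
by split; apply: ae_monotone => t fg t01; [exact: fg | move=> _; exact: fg].
Qed.

Lemma eq_ae_J3fun (f g : R -> R) (s : R) :
  measurable_fun setT f -> measurable_fun setT g ->
  f = g %[ae mu01] -> s \in `[0, 1]%R -> J3fun f s = J3fun g s.
Proof.
move=> mf mg /eq_ae_lebesgue01 fg s01.
have mk (h : R -> R) : measurable_fun setT h ->
    measurable_fun `[0, s] (fun t => (s - t) ^+ 2 / 2 * h t).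
  move=> mh; apply: measurable_funTS.
  apply: measurable_funM => //; apply: measurable_funM => //.
  by apply: measurable_funX; exact: measurable_funB.
rewrite /J3fun /Rintegral; congr fine; apply: ae_eq_integral => //.
- by apply/measurable_EFinP; exact: mk.
- by apply/measurable_EFinP; exact: mk.
- apply: ae_monotone fg => t fg /=; rewrite in_itv/= => /andP[t0 ts]; rewrite fg//.
  by move: s01; rewrite !in_itv/= t0 => /andP[_]; exact: le_trans.
Qed.

Lemma eq_J3adjfun (f g : R -> R) (t : R) : {in `[0, 1]%R, f =1 g} ->
  t \in `[0, 1]%R -> J3adjfun f t = J3adjfun g t.
Proof.
move=> fg; rewrite in_itv/= => /andP[t0 _].
apply: eq_Rintegral => s; rewrite mem_setE in_itv/= => /andP[ts s1].
by rewrite fg// in_itv/= s1 (le_trans t0).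
Qed.

Lemma continuous_Lfun01 (f : R -> R) : continuous f -> f \in Lfun mu01 2%:E.
Proof.
move=> cf.
have cnf : {within `[0, 1], continuous (Num.norm \o f)}.
  apply: continuous_subspaceT => t; apply: continuous_comp; first exact: cf.
  exact: norm_continuous.
have [c _ fc] := EVT_max ler01 cnf.
by apply: (@bounded_Lfun2 R f `|f c|) => //; exact: continuous_measurable_fun.
Qed.

End Operators.

(** * Regularity of the image of the threefold integration *)

Section Regularity.
Local Open Scope classical_set_scope.
Context {R : realType}.
Notation mu := (@lebesgue_measure R).
Notation mu01 := (@lebesgue01 R).

(** The retraction of the line onto the unit interval: composing with it extends
    a function continuous on the interval to the line. *)
Definition clamp (t : R) : R := Num.max 0 (Num.min t 1).

Lemma clamp01 t : 0 <= clamp t <= 1.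
Proof. by rewrite /clamp le_max lexx/= ge_max ler01 ge_min lexx orbT. Qed.

Lemma clamp_id t : t \in `[0, 1]%R -> clamp t = t.
Proof.
rewrite in_itv/= => /andP[t0 t1].
by rewrite /clamp (min_idPl t1) (max_idPr t0).
Qed.

Lemma continuous_clamp : continuous clamp.
Proof.
move=> t; apply: (@continuous_max R R (cst 0) (fun t => Num.min t 1)).
  exact: cst_continuous.
apply: (@continuous_min R R id (cst 1)); first exact: cvg_id.
exact: cst_continuous.
Qed.

Lemma continuous_comp_clamp (g : R -> R) :
  {within `[0, 1], continuous g} -> continuous (g \o clamp).
Proof.
move=> /subspace_continuousP gc t.
have gt := gc (clamp t) (clamp01 t).
apply: (cvg_trans _ gt) => P /= gP.
have H : \forall u \near t, `[0, 1] (clamp u) -> P (g (clamp u)).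
  exact: continuous_clamp t _ gP.
by apply: filterS H => u; apply; exact: clamp01.
Qed.

Lemma Rintegral_linear_weight {A F0 F1 : R -> R} : continuous A ->
  (forall t : R, is_derive t 1 F0 (F1 t)) -> (forall t : R, is_derive t 1 F1 (A t)) ->
  F0 0 = 0 -> F1 0 = 0 -> forall s : R, 0 <= s ->
  \int[mu]_(t in `[0, s]) ((s - t) * A t) = F0 s.
Proof.
move=> cA d0 d1 F00 F10 s s0.
pose H t := (s - t) * F1 t + F0 t.
have ds (t : R) : is_derive t 1 (fun t : R => s - t) (- 1).
  apply: (is_derive_eq (derB (is_derive_cst s t 1) (is_derive_id t 1))).
  by rewrite sub0r.
have dH (t : R) : is_derive t 1 H ((s - t) * A t).
  apply: (is_derive_eq (derD (derM (ds t) (d1 t)) (d0 t))).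
  by ring.
rewrite (@Rintegral_primitive R (fun t => (s - t) * A t) H)//.
  by rewrite /H F10 F00 subrr; ring.
exact: continuous_mul (is_derive_continuous ds) cA.
Qed.

(** The kernel of x |-> int_0^s x(t) dt on the unit interval. *)
Definition kerJ (st : R * R) : R :=
  if (0 <= st.2) && (st.2 <= st.1) && (st.1 <= 1) then 1 else 0.

Lemma mkerJ : measurable_fun setT kerJ.
Proof.
apply: measurable_fun_ifT => //.
by apply: measurable_and; first apply: measurable_and; exact: measurable_fun_ler.
Qed.

Lemma kerJ_le1 st : `|kerJ st| <= 1.
Proof. by rewrite /kerJ; case: ifPn; rewrite ?normr1 ?normr0. Qed.

Definition ramp (S s : R) : R := if s <= S then S - s else 0.

Lemma ramp_Lfun (S : R) : 0 <= S <= 1 -> ramp S \in Lfun mu01 2%:E.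
Proof.
move=> S01; apply: (@bounded_Lfun2 R _ 1).
  by apply: measurable_fun_ifT => //; [exact: measurable_fun_ler|exact: measurable_funB].
move=> t; rewrite in_itv/= => /andP[t0 t1]; rewrite /ramp.
by case: ifPn => tS; rewrite ?normr0// ger0_norm; lra.
Qed.

(** Exchanging the integrals, int_0^S (S - s) int_0^s x(t) dt ds is the integral
    of x(t) against int_t^S (S - s) ds = (S - t)^2 / 2. The exchange is the
    adjunction of the kernel operators of [kerJ], tested on the function [ramp S],
    which cuts the outer integral at S. *)
Lemma J3fun_double_integral (x : L2 R) (S : R) : S \in `[0, 1]%R ->
  J3fun x S = \int[mu]_(s in `[0, S]) ((S - s) * \int[mu]_(t in `[0, s]) x t).
Proof.
rewrite in_itv/= => S01; have /andP[S0 S1] := S01.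
pose z : L2 R := Lfun_Sub (lee1n 2) (ramp_Lfun S S01).
have := kernelop_adjoint x z mkerJ kerJ_le1.
have -> : \int[mu]_(s in `[0, 1]) (kernelop kerJ x s * z s) =
    \int[mu]_(s in `[0, S]) ((S - s) * \int[mu]_(t in `[0, s]) x t).
  rewrite [LHS]Rintegral_mkcond [RHS]Rintegral_mkcond.
  apply: eq_Rintegral => s _; rewrite !patchE !mem_setE !in_itv/= /ramp.
  case: (leP 0 s) => //= s0.
  case: (leP s S) => sS; last by rewrite mulr0; case: ifP.
  rewrite (le_trans sS S1) mulrC; congr (_ * _).
  rewrite /kernelop [RHS]Rintegral_mkcond; apply: eq_Rintegral => t _.
  rewrite /kerJ /Defs.cut !patchE/= !mem_setE !in_itv/= (le_trans sS S1) andbT.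
  case: ifPn => [/andP[t0 ts]|]; last by rewrite mul0r.
  by rewrite t0 (le_trans ts (le_trans sS S1)) mul1r.
move=> ->.
rewrite /J3fun [LHS]Rintegral_mkcond [RHS]Rintegral_mkcond.
apply: eq_Rintegral => t _; rewrite !patchE !mem_setE !in_itv/=.
case: (leP 0 t) => //= t0.
have kE : \int[mu]_(s in `[t, S]) (S - s) = kernelop (fun ts => kerJ (ts.2, ts.1)) z t.
  rewrite [LHS]Rintegral_mkcond; apply: eq_Rintegral => s _.
  rewrite /kerJ /Defs.cut !patchE/= !mem_setE !in_itv/= t0/= /ramp.
  case: (leP t s) => /= ts; last by rewrite mul0r.
  rewrite (le_trans t0 ts)/=.
  case: (leP s S) => sS /=; last by case: ifP; rewrite mulr0.
  by rewrite (le_trans sS S1) mul1r.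
rewrite -kE; case: (leP t S) => tS; last first.
  by rewrite set_itv_ge ?Rintegral_set0 ?mulr0; [case: ifP | rewrite bnd_simp -ltNge].
rewrite (le_trans tS S1) mulrC; congr (_ * _).
have dH (s : R) : is_derive s 1 (fun s : R => - ((S - s) * (S - s) / 2)) (S - s).
  have ds : is_derive s 1 (fun s : R => S - s) (- 1).
    apply: (is_derive_eq (derB (is_derive_cst S s 1) (is_derive_id s 1))).
    by rewrite sub0r.
  by apply: (is_derive_eq (derN (derZr 2^-1 (derM ds ds)))); field.
rewrite (@Rintegral_primitive R (fun s => S - s)
  (fun s : R => - ((S - s) * (S - s) / 2)))//.
  by field.
move=> s; apply: cvgB; [exact: cvg_cst|exact: cvg_id].
Qed.

(** For x in L^2 this splits the threefold integration into one Lebesgue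
    primitive A, merely continuous, followed by two classical primitives. *)
Lemma J3fun_regular (x : L2 R) : exists A F1 F0 : R -> R,
  [/\ continuous A, forall t : R, is_derive t 1 F0 (F1 t),
      forall t : R, is_derive t 1 F1 (A t),
      forall s, s \in `[0, 1]%R -> A s = \int[mu]_(t in `[0, s]) x t
    & forall s, s \in `[0, 1]%R -> J3fun x s = F0 s].
Proof.
have cA0 := parameterized_integral_continuous ler01 (L2_integrable x).
pose A := (fun s => parameterized_integral mu 0 s x) \o clamp.
have cA : continuous A by exact: continuous_comp_clamp.
have AE s : s \in `[0, 1]%R -> A s = \int[mu]_(t in `[0, s]) x t.
  by move=> s01; rewrite /A/= clamp_id.
have [F1 [F10 d1]] := primitive_exists A 0 cA.
have [F0 [F00 d0]] := primitive_exists F1 0 (is_derive_continuous d1).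
exists A, F1, F0; split => // s s01.
have /andP[s0 s1] : 0 <= s <= 1 by move: s01; rewrite in_itv.
rewrite (J3fun_double_integral _ _ s01).
rewrite -(Rintegral_linear_weight cA d0 d1 F00 F10 s s0).
apply: eq_Rintegral => t; rewrite mem_setE in_itv/= => /andP[t0 ts].
by rewrite AE// in_itv/= t0 (le_trans ts).
Qed.

End Regularity.

(** * Injectivity and positivity *)

Section Injectivity.
Local Open Scope classical_set_scope.
Context {R : realType}.
Notation mu := (@lebesgue_measure R).
Notation mu01 := (@lebesgue01 R).

(** Two derivatives of J3 x = 0 give int_0^s x = 0 on [0, 1), and almost every t is
    a point where the derivative of this integral is x(t). *)
Lemma J3fun_eq0 (x : L2 R) :
  (forall s, 0 <= s < 1 -> J3fun x s = 0) -> x = cst 0 %[ae mu01].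
Proof.
move=> z0; have [A [F1 [F0 [cA d0 d1 AE zE]]]] := J3fun_regular x.
have sub s : 0 <= s < 1 -> s \in `[0, 1]%R.
  by move=> /andP[s0 s1]; rewrite in_itv/= s0 ltW.
have F00 s : 0 <= s < 1 -> F0 s = 0 by move=> s01; rewrite -zE ?z0// sub.
have A0 := vanishing_derivative _ _ _ _ d1 (vanishing_derivative _ _ _ _ d0 F00).
have ix : locally_integrable [set: R] (Defs.cut x).
  exact: integrable_locally (measurable_itv _) (L2_integrable x).
have := @FTC1 R (Defs.cut x) (BLeft 0) _ ix.
move=> /(_ _)[y|N1 [mN1 N10 N1P]].
  exact: integrableS (integrable_cut x).
(* At 1 the integral is only known to vanish on the left, and the
   differentiation theorem excludes the left endpoint 0. *)
have [N [mN N0 N1N]] : mu.-negligible (N1 `|` ([set 0] `|` [set 1])).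
  apply: negligibleU; first by exists N1; split.
  have null1 (r : R) : mu.-negligible [set r].
    by exists [set r]; split => //; exact: lebesgue_measure_set1.
  exact: negligibleU.
apply/eq_ae_lebesgue01; exists N; split => //; apply: subset_trans N1N.
move=> t /= /not_implyP[t01 xt]; case: (eqVneq t 0) => [->|tn0].
  by right; left.
case: (eqVneq t 1) => [->|t1]; [by right; right|left].
apply: N1P => /= H; apply: xt.
move: t01; rewrite in_itv/= => /andP[t0 t1'].
have lt1 : t < 1 by rewrite lt_neqAle t1.
have [|dF EF] := H.
  by rewrite lte_fin lt_neqAle eq_sym tn0.
move: EF; rewrite derive1E /Defs.cut patchE mem_setE in_itv/= t0 t1'/= => <-.
apply: (zero_is_derive _ _ 1 t lt1 _ (DeriveDef dF erefl)) => u /andP[tu u1].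
have u0 : 0 <= u by exact: le_trans tu.
have u01 : 0 <= u < 1 by rewrite u0.
transitivity (A u); last exact: A0.
rewrite AE ?sub//.
apply: eq_Rintegral => v; rewrite mem_setE in_itv/= => /andP[v0 vu].
by rewrite /Defs.cut patchE mem_setE in_itv/= v0 (le_trans vu (ltW u1)).
Qed.

(** If lambda <= 0, then |J3 x|^2 = lambda |x|^2 <= 0, hence the continuous
    representative F0 of J3 x vanishes: the primitive G of F0^2 is nondecreasing
    and satisfies G (1) <= 0 = G (0), so it is constant on the interval. *)
Lemma eigenvalue_gt0 (lambda : R) :
  is_eigenvalue (fun x : L2 R => J3adj (J3 x)) lambda -> 0 < lambda.
Proof.
move=> [x [xn0 xE]]; rewrite ltNge; apply/negP => l0; apply: xn0.
have [A [F1 [F0 [cA d0 d1 AE zE]]]] := J3fun_regular x.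
have cF0 := is_derive_continuous d0.
have cF2 := continuous_mul cF0 cF0.
have [G [G0 dG]] := primitive_exists _ 0 cF2.
have GE a b : a <= b -> \int[mu]_(t in `[a, b]) (F0 t * F0 t) = G b - G a.
  by move=> ab; exact: Rintegral_primitive.
have Gle a b : a <= b -> G a <= G b.
  move=> ab; rewrite -subr_ge0 -GE// Rintegral_ge0// => t _.
  by rewrite -expr2 sqr_ge0.
have G1 : G 1 <= 0.
  have <- : \int[mu]_(t in `[0, 1]) (F0 t * F0 t) = G 1 by rewrite GE// G0 subr0.
  have -> : \int[mu]_(t in `[0, 1]) (F0 t * F0 t) = inner (J3 x) (J3 x).
    by apply: eq_Rintegral => t; rewrite mem_setE => t01; rewrite /= zE.
  rewrite J3adjP /inner /Rintegral.
  have mx : measurable_fun setT x := measurable_funPT x.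
  rewrite (@ae_eq_integral _ _ _ mu `[0, 1] (fun t => (- (- lambda * (x t * x t)))%:E)).
  - have xx0 t : (0 <= (- lambda * (x t * x t))%:E)%E.
      by rewrite lee_fin mulr_ge0 ?oppr_ge0// -expr2 sqr_ge0.
    under eq_integral do rewrite EFinN.
    apply: fine_le0; rewrite integral_ge0N//.
    by rewrite oppe_le0; exact: integral_ge0.
  - exact: measurable_itv.
  - apply/measurable_EFinP; apply: measurable_funTS.
    by apply: measurable_funM.
  - apply/measurable_EFinP; apply: measurable_funTS.
    by apply: measurable_funN; apply: measurable_funM => //; exact: measurable_funM.
  - move/eq_ae_lebesgue01: xE; apply: ae_monotone => t xt t01.
    by rewrite xt// (_ : (lambda *: x) t = lambda * x t)//; congr EFin; ring.
apply: J3fun_eq0 => s /andP[s0 s1].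
rewrite zE ?in_itv/= ?s0 ?ltW//.
suff : F0 s * F0 s = 0 by move/eqP; rewrite mulf_eq0 orbb => /eqP.
apply: (zero_is_derive G _ 1 s s1 _ (dG s)) => u /andP[su u1].
apply/eqP; rewrite eq_le (le_trans (Gle _ _ (ltW u1)) G1) -[X in X <= _]G0.
by rewrite Gle// (le_trans s0).
Qed.

End Injectivity.

(** * The boundary value problem *)

Section Boundary.
Context {R : realType}.
Implicit Types w a b c : R.

(** Applied to the row vector (a, b, c), column j gives w^(-j) times the j-th
    derivative of a phi_0 (w t) + b phi_1 (w t) + c phi_2 (w t) at t = 1; the signs
    come from phi_0' = - phi_5. *)
Definition boundary_mx w : 'M[R]_3 := \matrix_(i, j) nth 0 (nth [::]
  [:: [:: phi0 w; - phi5 w; - phi4 w];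
      [:: phi1 w; phi0 w; - phi5 w];
      [:: phi2 w; phi1 w; phi0 w]] i) j.

Lemma det_boundary_mx w : 36 * \det (boundary_mx w) =
  8 * cos w + cos (2 * w) + 2 * cos w * cosh (Num.sqrt 3 * w)
  + 16 * cos (1 / 2 * w) * cosh (Num.sqrt 3 / 2 * w) + 9.
Proof.
rewrite -det_phi; congr (_ * _).
rewrite (expand_det_row _ ord0) !big_ord_recl big_ord0 /cofactor.
rewrite !(expand_det_row _ ord0) !big_ord_recl !big_ord0 /cofactor.
rewrite !det_mx11 !mxE /=.
by ring.
Qed.

Definition boundary_conditions w a b c :=
  [/\ a * phi0 w + b * phi1 w + c * phi2 w = 0,
      - (a * phi5 w) + b * phi0 w + c * phi1 w = 0
    & - (a * phi4 w) - b * phi5 w + c * phi0 w = 0].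

Lemma det_boundary_mx0P w : \det (boundary_mx w) = 0 <->
  exists a b c, ~ [/\ a = 0, b = 0 & c = 0] /\ boundary_conditions w a b c.
Proof.
have mulE (v : 'rV[R]_3) j : (v *m boundary_mx w) 0 j =
    v 0 ord0 * boundary_mx w ord0 j
    + v 0 (lift ord0 ord0) * boundary_mx w (lift ord0 ord0) j
    + v 0 (lift ord0 (lift ord0 ord0)) * boundary_mx w (lift ord0 (lift ord0 ord0)) j.
  by rewrite mxE !big_ord_recl big_ord0 addr0 addrA.
split=> [/eqP/det0P[v v0 vM]|[a [b [c [abc0 [E1 E2 E3]]]]]].
- exists (v 0 ord0), (v 0 (lift ord0 ord0)), (v 0 (lift ord0 (lift ord0 ord0))); split.
    move=> [a0 b0 c0]; move/eqP: v0; apply; apply/rowP => i; rewrite [RHS]mxE.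
    case: (unliftP ord0 i) => [j ->|->//].
    case: (unliftP ord0 j) => [k ->|->//].
    by case: (unliftP ord0 k) => [[]//|->].
  have vM0 j : (v *m boundary_mx w) 0 j = 0 by rewrite vM mxE.
  have := vM0 ord0; have := vM0 (lift ord0 ord0).
  have := vM0 (lift ord0 (lift ord0 ord0)).
  rewrite !mulE !mxE /= => E3 E2 E1.
  by split; [rewrite -[RHS]E1|rewrite -[RHS]E2|rewrite -[RHS]E3]; ring.
- apply/eqP/det0P; exists (\row_i nth 0 [:: a; b; c] i).
    apply/eqP => v0; apply: abc0.
    have vi i : (\row_(i < 3) nth 0 [:: a; b; c] i) 0 i = 0 by rewrite v0 mxE.
    have := vi ord0; have := vi (lift ord0 ord0).
    have := vi (lift ord0 (lift ord0 ord0)).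
    by rewrite !mxE.
  apply/rowP => i; rewrite mulE !mxE /=.
  case: (unliftP ord0 i) => [j ->|->/=]; last by rewrite -[RHS]E1; ring.
  case: (unliftP ord0 j) => [k ->|->/=]; last by rewrite -[RHS]E2; ring.
  case: (unliftP ord0 k) => [[]//|->/=].
  by rewrite -[RHS]E3; ring.
Qed.

End Boundary.

(** * Eigenfunctions and the boundary value problem *)

Section Eigenfunctions.
Local Open Scope classical_set_scope.
Context {R : realType}.
Notation mu01 := (@lebesgue01 R).
Implicit Types (lambda w a b c : R).

(** Regularity is gained by reading J3adj (J3 x) = lambda x from right to left: Z is
    a continuous extension of J3 x; the threefold primitive Y0 of - Z whose
    derivatives of order 0, 1, 2 vanish at 1 equals J3adj (J3 x) on the interval;
    so X = Y0 / lambda is a smooth representative of x, and the threefold primitive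
    z0 of X from 0 agrees with Z on the interval. There z0''' = w^6 Y0 and
    Y0''' = - z0. The powers of w in v0, ..., v5 bring this system to the form of
    [taylor6] without denominators; v3 is a multiple of X. *)
Lemma boundary_conditions_of_eigenvalue lambda w : 0 < w -> lambda * w ^+ 6 = 1 ->
  is_eigenvalue (fun x : L2 R => J3adj (J3 x)) lambda ->
  exists a b c, ~ [/\ a = 0, b = 0 & c = 0] /\ boundary_conditions w a b c.
Proof.
move=> w0 lw [x [xn0 xE]].
have l0 : lambda != 0 by apply: contra_eq_neq lw => ->; rewrite mul0r eq_sym oner_eq0.
have lE : lambda^-1 = w ^+ 6 by rewrite -[LHS]mulr1 -lw mulKf.
have [A [F1 [F0 [cA d0 d1 AE zE]]]] := J3fun_regular x.
pose Z := F0 \o clamp.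
have ZE s : s \in `[0, 1]%R -> J3fun x s = Z s.
  by move=> s01; rewrite zE// /Z/= clamp_id.
have cZ : continuous Z.
  apply: continuous_comp_clamp; apply: continuous_subspaceT.
  exact: is_derive_continuous d0.
have cNZ : continuous (fun t => - Z t) by move=> t; apply: cvgN; exact: cZ.
have [Y2 [Y21 dY2]] := primitive_exists _ 1 cNZ.
have [Y1 [Y11 dY1]] := primitive_exists _ 1 (is_derive_continuous dY2).
have [Y0 [Y01 dY0]] := primitive_exists _ 1 (is_derive_continuous dY1).
pose X t := w ^+ 6 * Y0 t.
have dX (t : R) : is_derive t 1 X (w ^+ 6 * Y1 t) := derZ _ (dY0 t).
have cX := is_derive_continuous dX.
have xX : x = X %[ae mu01].
  move/eq_ae_lebesgue01: xE => xE; apply/eq_ae_lebesgue01.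
  apply: ae_monotone xE => t xE t01.
  have t1 : t <= 1 by move: t01; rewrite in_itv => /andP[].
  have : J3adjfun (J3fun x) t = lambda * x t := xE t01.
  rewrite (eq_J3adjfun _ _ _ ZE t01).
  rewrite (J3adjfun_primitive cZ dY0 dY1 dY2 Y01 Y11 Y21 _ t1) /X => ->.
  by rewrite -lE mulKf.
have [z2 [z20 dz2]] := primitive_exists _ 0 cX.
have [z1 [z10 dz1]] := primitive_exists _ 0 (is_derive_continuous dz2).
have [z0 [z00 dz0]] := primitive_exists _ 0 (is_derive_continuous dz1).
have Zz t : 0 <= t <= 1 -> Z t = z0 t.
  move=> t01; have t01' : t \in `[0, 1]%R by rewrite in_itv.
  have mX := continuous_measurable_fun cX.
  rewrite -ZE// (eq_ae_J3fun x X t (measurable_funPT x) mX xX t01').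
  by have /andP[t0 _] := t01; rewrite (J3fun_primitive cX dz0 dz1 dz2 z00 z10 z20).
pose v0 t := w ^+ 2 * z0 t.
pose v1 t := w * z1 t.
pose v3 t := w ^+ 5 * Y0 t.
pose v4 t := w ^+ 4 * Y1 t.
pose v5 t := w ^+ 3 * Y2 t.
have dv0 (t : R) : is_derive t 1 v0 (w * v1 t).
  by apply: (is_derive_eq (derZ _ (dz0 t))); rewrite /v1; ring.
have dv1 (t : R) : is_derive t 1 v1 (w * z2 t).
  exact: derZ (dz1 t).
have dv2 (t : R) : is_derive t 1 z2 (w * v3 t).
  by apply: (is_derive_eq (dz2 t)); rewrite /v3 /X; ring.
have dv3 (t : R) : is_derive t 1 v3 (w * v4 t).
  by apply: (is_derive_eq (derZ _ (dY0 t))); rewrite /v4; ring.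
have dv4 (t : R) : is_derive t 1 v4 (w * v5 t).
  by apply: (is_derive_eq (derZ _ (dY1 t))); rewrite /v5; ring.
have dv5 (t : R) : 0 <= t <= 1 -> is_derive t 1 v5 (w * - v0 t).
  move=> t01; apply: (is_derive_eq (derZ _ (dY2 t))).
  by rewrite Zz// /v0; ring.
have dN (v v' : R -> R) (t : R) : is_derive t 1 v (w * v' t) ->
    is_derive t 1 (fun t => - v t) (w * - v' t).
  by move=> dv; rewrite mulrN; exact: derN.
(* The solution v3 has derivatives v4, v5, -v0, -v1, -v2, and the last three
   vanish at 0. *)
have v3E t : 0 <= t <= 1 ->
    v3 t = v3 0 * phi0 (w * t) + v4 0 * phi1 (w * t) + v5 0 * phi2 (w * t).
  move=> /andP[t0 t1].
  have lt1 u : 0 <= u <= t -> 0 <= u <= 1 by move=> /andP[-> /le_trans->].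
  rewrite (taylor6 w t v3 v4 v5 (fun t => - v0 t) (fun t => - v1 t) (fun t => - z2 t)
    t0 (fun u _ => dv3 u) (fun u _ => dv4 u) (fun u ut => dv5 u (lt1 u ut))
    (fun u _ => dN _ _ u (dv0 u)) (fun u _ => dN _ _ u (dv1 u))
    (fun u _ => dN _ _ u (dv2 u))).
  by rewrite /v0 /v1 z00 z10 z20; ring.
exists (v3 0), (v4 0), (v5 0); split.
  move=> [v30 v40 v50]; apply: xn0.
  move/eq_ae_lebesgue01: xX => xX; apply/eq_ae_lebesgue01.
  apply: ae_monotone xX => t xX t01; rewrite xX//.
  have v3t : w ^+ 5 * Y0 t = 0.
    by rewrite -/(v3 t) v3E ?v30 ?v40 ?v50 ?mul0r ?addr0// -in_itv.
  by rewrite /X exprS -mulrA v3t mulr0.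
have v31 : v3 1 = 0 by rewrite /v3 Y01 mulr0.
have v41 : v4 1 = 0 by rewrite /v4 Y11 mulr0.
have v51 : v5 1 = 0 by rewrite /v5 Y21 mulr0.
split.
- by have := v3E 1; rewrite v31 mulr1 ler01 lexx => <-.
- have := taylor6 w 1 v4 v5 (fun t => - v0 t) (fun t => - v1 t) (fun t => - z2 t)
    (fun t => - v3 t) ler01 (fun u _ => dv4 u) dv5 (fun u _ => dN _ _ u (dv0 u))
    (fun u _ => dN _ _ u (dv1 u)) (fun u _ => dN _ _ u (dv2 u))
    (fun u _ => dN _ _ u (dv3 u)).
  rewrite v41 mulr1 /v0 /v1 z00 z10 z20 => E; rewrite [RHS]E.
  by ring.
- have := taylor6 w 1 v5 (fun t => - v0 t) (fun t => - v1 t) (fun t => - z2 t)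
    (fun t => - v3 t) (fun t => - v4 t) ler01 dv5 (fun u _ => dN _ _ u (dv0 u))
    (fun u _ => dN _ _ u (dv1 u)) (fun u _ => dN _ _ u (dv2 u))
    (fun u _ => dN _ _ u (dv3 u)) (fun u _ => dN _ _ u (dv4 u)).
  rewrite v51 mulr1 /v0 /v1 z00 z10 z20 => E; rewrite [RHS]E.
  by ring.
Qed.

Lemma der_comb (k w a b c : R) {f g h f' g' h' : R -> R} :
  (forall u : R, is_derive u 1 f (f' u)) -> (forall u : R, is_derive u 1 g (g' u)) ->
  (forall u : R, is_derive u 1 h (h' u)) -> forall t : R,
  is_derive t 1 (fun t => k * (a * f (w * t) + b * g (w * t) + c * h (w * t)))
    (k * w * (a * f' (w * t) + b * g' (w * t) + c * h' (w * t))).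
Proof.
move=> df dg dh t.
apply: (is_derive_eq (derZ k (derD (derD (derZ a (der_comp_scale w (df _)))
  (derZ b (der_comp_scale w (dg _)))) (derZ c (der_comp_scale w (dh _)))))).
by ring.
Qed.

(** The eigenfunction is x0 = w^3 (a phi_0 + b phi_1 + c phi_2) (w t), whose threefold
    primitive z0 from 0 is a phi_3 + b phi_4 + c phi_5; the boundary conditions
    make lambda x0 the threefold primitive of - z0 from 1. If x0 vanished almost
    everywhere, then z0 = J3 x0 and all its derivatives would vanish at 0,
    where those of order 3, 4, 5 are multiples of a, b, c. *)
Lemma eigenvalue_of_boundary_conditions lambda w a b c :
  0 < w -> lambda * w ^+ 6 = 1 ->
  ~ [/\ a = 0, b = 0 & c = 0] -> boundary_conditions w a b c ->
  is_eigenvalue (fun x : L2 R => J3adj (J3 x)) lambda.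
Proof.
move=> w0 lw abc0 [E1 E2 E3].
have dNphi5 (u : R) : is_derive u 1 (fun u => - phi5 u) (- phi4 u) := derN (der_phi5 u).
have dNphi4 (u : R) : is_derive u 1 (fun u => - phi4 u) (- phi3 u) := derN (der_phi4 u).
pose comb k (f g h : R -> R) t := k * (a * f (w * t) + b * g (w * t) + c * h (w * t)).
pose z0 := comb 1 phi3 phi4 phi5.
pose z1 := comb w phi2 phi3 phi4.
pose z2 := comb (w ^+ 2) phi1 phi2 phi3.
pose x0 := comb (w ^+ 3) phi0 phi1 phi2.
pose x1 := comb (w ^+ 4) (fun u => - phi5 u) phi0 phi1.
pose x2 := comb (w ^+ 5) (fun u => - phi4 u) (fun u => - phi5 u) phi0.
have dz0 (t : R) : is_derive t 1 z0 (z1 t).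
  apply: (is_derive_eq (der_comb _ _ _ _ _ der_phi3 der_phi4 der_phi5 t)).
  by rewrite mul1r.
have dz1 (t : R) : is_derive t 1 z1 (z2 t).
  exact: (is_derive_eq (der_comb _ _ _ _ _ der_phi2 der_phi3 der_phi4 t)).
have dz2 (t : R) : is_derive t 1 z2 (x0 t).
  apply: (is_derive_eq (der_comb _ _ _ _ _ der_phi1 der_phi2 der_phi3 t)).
  by rewrite /x0 /comb -exprSr.
have dx0 (t : R) : is_derive t 1 x0 (x1 t).
  apply: (is_derive_eq (der_comb _ _ _ _ _ der_phi0 der_phi1 der_phi2 t)).
  by rewrite /x1 /comb -exprSr.
have dx1 (t : R) : is_derive t 1 x1 (x2 t).
  apply: (is_derive_eq (der_comb _ _ _ _ _ dNphi5 der_phi0 der_phi1 t)).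
  by rewrite /x2 /comb -exprSr.
have dx2 (t : R) : is_derive t 1 x2 (- (w ^+ 6 * z0 t)).
  apply: (is_derive_eq (der_comb _ _ _ _ _ dNphi4 dNphi5 der_phi0 t)).
  by rewrite /z0 /comb; ring.
have [p0 p1 p2 [p3 p4 p5]] := @phi_at0 R.
have cx0 := is_derive_continuous dx0.
pose x : L2 R := Lfun_Sub (lee1n 2) (continuous_Lfun01 x0 cx0).
have J3x s : s \in `[0, 1]%R -> J3fun x s = z0 s.
  rewrite in_itv/= => /andP[s0 _].
  rewrite (J3fun_primitive cx0 dz0 dz1 dz2)// /z0 /z1 /z2 /comb !mulr0
    ?p1 ?p2 ?p3 ?p4 ?p5; by ring.
exists x; split.
- move=> x_eq0; apply: abc0.
  have z00 s : 0 <= s < 1 -> z0 s = 0.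
    move=> /andP[s0 s1]; have s01 : s \in `[0, 1]%R by rewrite in_itv/= s0 ltW.
    have m0 : measurable_fun setT (cst 0 : R -> R) by exact: measurable_cst.
    rewrite -J3x// (eq_ae_J3fun x (cst 0) s (measurable_funPT x) m0 x_eq0 s01).
    have dc (t : R) : is_derive t 1 (cst 0 : R -> R) (cst 0 t) := is_derive_cst _ _ _.
    by rewrite (J3fun_primitive (is_derive_continuous dc) dc dc dc).
  have x00 := vanishing_derivative _ _ _ _ dz2
    (vanishing_derivative _ _ _ _ dz1 (vanishing_derivative _ _ _ _ dz0 z00)).
  have x10 := vanishing_derivative _ _ _ _ dx0 x00.
  have x20 := vanishing_derivative _ _ _ _ dx1 x10.
  have I0 : 0 <= (0 : R) < 1 by rewrite lexx ltr01.
  have wn n (r : R) : w ^+ n * r = 0 -> r = 0.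
    by move/eqP; rewrite mulf_eq0 expf_eq0 (gt_eqF w0) andbF => /eqP.
  have := x00 0 I0; have := x10 0 I0; have := x20 0 I0.
  rewrite /x0 /x1 /x2 /comb !mulr0 p0 p1 p2 p4 p5.
  move=> /wn H2 /wn H1 /wn H0.
  by split; [rewrite -[RHS]H0|rewrite -[RHS]H1|rewrite -[RHS]H2]; ring.
- apply/eq_ae_lebesgue01; apply: aeW => t t01.
  have t1 : t <= 1 by move: t01; rewrite in_itv => /andP[].
  transitivity (J3adjfun (J3fun x) t); first by [].
  rewrite (eq_J3adjfun _ _ _ J3x t01).
  have dy2 (u : R) : is_derive u 1 (fun t => lambda * x2 t) (- z0 u).
    apply: (is_derive_eq (derZ lambda (dx2 u))).
    by rewrite mulrN mulrA lw mul1r.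
  rewrite (J3adjfun_primitive (is_derive_continuous dz0) (fun u => derZ lambda (dx0 u))
    (fun u => derZ lambda (dx1 u)) dy2)//.
  + by rewrite /x0 /comb !mulr1 E1 !mulr0.
  + by rewrite /x1 /comb !mulr1 mulrN E2 !mulr0.
  + by rewrite /x2 /comb !mulr1 !mulrN E3 !mulr0.
Qed.

End Eigenfunctions.

(** * The transcendental equation *)

Lemma powR_sixth_root (R : realType) (lambda : R) : 0 < lambda ->
  lambda * (lambda `^ (- (1 / 6))) ^+ 6 = 1.
Proof.
move=> l0; rewrite -powR_mulrn ?powR_ge0// -powRrM.
rewrite (_ : - (1 / 6) * 6%:R = - 1 :> R); last by field.
by rewrite powR_inv1 ?ltW// mulfV ?gt_eqF.
Qed.

Theorem corollary1 (R : realType) (lambda : R) :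
  is_eigenvalue (fun x : L2 R => J3adj (J3 x)) lambda <->
  0 < lambda /\
  8 * cos (lambda `^ (- (1 / 6))) + cos (2 * lambda `^ (- (1 / 6)))
  + 2 * cos (lambda `^ (- (1 / 6)))
      * cosh (Num.sqrt 3 * lambda `^ (- (1 / 6)))
  + 16 * cos (1 / 2 * lambda `^ (- (1 / 6)))
      * cosh (Num.sqrt 3 / 2 * lambda `^ (- (1 / 6)))
  + 9 = 0.
Proof.
rewrite -det_boundary_mx.
split=> [ev|[l0 detE]].
- have l0 := eigenvalue_gt0 lambda ev; split => //.
  have /det_boundary_mx0P-> := boundary_conditions_of_eigenvalue lambda _
    (powR_gt0 _ l0) (powR_sixth_root _ _ l0) ev.
  by rewrite mulr0.
- have /det_boundary_mx0P[a [b [c [abc0 bc]]]] :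
      \det (boundary_mx (lambda `^ (- (1 / 6)))) = 0.
    by move/eqP: detE; rewrite mulf_eq0 pnatr_eq0/= => /eqP.
  exact: eigenvalue_of_boundary_conditions (powR_gt0 _ l0)
    (powR_sixth_root _ _ l0) abc0 bc.
Qed.
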